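(* Let $A,B$ be coherent $k\times k$ transition matrices, let $X(A,B)$ be the associated two-dimensional matrix shift, and let $\mathcal{A}(m,n)=C^*(G(m,n))$ and $\bar{\mathcal{A}}(m,n)=C^*(\bar G(m,n))$ ($m,n\ge 2$) be the associated graph $C^*$-algebras. Then for every $n\ge 2$ $$\bar{\mathcal{A}}(2,n)\cong \mathcal{O}_{A_n}\quad\text{and}\quad \mathcal{A}(n,2)\cong\mathcal{O}_{B_n},$$ where $(A_n)_{n\ge1}$ and $(B_n)_{n\ge 1}$ are the inductively constructed transition matrices defined in the context. Moreover these matrices define two sequences $(Y(A_n))_{n\ge 1}$ and $(Y(B_n))_{n\ge 1}$ of one-dimensional shifts of finite type associated to $X(A,B)$: $Y(A_n)$, the set of restrictions of elements of $X(A,B)$ to the strip $K_n=\{(i,j)\in\mathbb{N}^2: 0\le j\le n-1\}$, is the one-dimensional Markov shift with alphabet $\mathcal{B}(1,n)$ and transition matrix $A_n$, and $Y(B_n)$, the set of restrictions of elements of $X(A,B)$ to $L_n=\{(i,j)\in\mathbb{N}^2: 0\le i\le n-1\}$, is the one-dimensional Markov shift with alphabet $\mathcal{B}(n,1)$ and transition matrix $B_n$.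
   Context: $\mathbb{N}=\{0,1,2,\dots\}$. Two $k\times k$ matrices $A,B$ with entries in $\{0,1\}$, indexed by $S=\{0,\dots,k-1\}$ and with no identically zero rows or columns, are coherent if for all $i,j$: $(AB)(i,j)>0$ iff $(BA)(i,j)>0$, and $(AB^t)(i,j)>0$ iff $(B^tA)(i,j)>0$, where $B^t$ is the transpose. The matrix shift is $$X(A,B)=\{x\in S^{\mathbb{N}^2}: A(x(i,j),x(i+1,j))=1\text{ and }B(x(i,j),x(i,j+1))=1\text{ for all }(i,j)\in\mathbb{N}^2\}.$$ The first coordinate is horizontal (increasing to the right), the second is vertical (increasing upward). For $m,n\ge 1$, $\mathcal{B}(m,n)$ is the set of $m\times n$ blocks (width $m$, height $n$) occurring in elements of $X(A,B)$. For $m\geq 1$, $n\ge2$, $G(m,n)$ is the finite directed graph with edge set $\mathcal{B}(m,n)$ and vertex set $\mathcal{B}(m,n-1)$, where the source $s(\beta)$ of an edge $\beta$ is its lower $m\times(n-1)$ block and the range $r(\beta)$ is its upper $m\times (n-1)$ block. For $m\ge 2$, $n\ge 1$, $\bar G(m,n)$ is the finite directed graph with edge set $\mathcal{B}(m,n)$ and vertex set $\mathcal{B}(m-1,n)$, where the source of $\beta$ is its left $(m-1)\times n$ block and the range is its right $(m-1)\times n$ block. The matrices $A_n$ are indexed by $\mathcal{B}(1,n)$ and defined by $A_1=A$ and, for $1\times(n+1)$ blocks occurring in $X(A,B)$ written as $\begin{pmatrix}j\\ \alpha\end{pmatrix}$ with top symbol $j\in S$ and lower $1\times n$ block $\alpha$,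 $$A_{n+1}\left(\begin{pmatrix}j\\ \alpha\end{pmatrix},\begin{pmatrix}j'\\ \alpha'\end{pmatrix}\right)=1 \iff A(j,j')A_n(\alpha,\alpha')=1,$$ the entry being $0$ otherwise. The matrices $B_n$, indexed by $\mathcal{B}(n,1)$, are defined similarly with the roles of $A,B$ and of the two coordinate directions interchanged: $B_1=B$ and $B_{n+1}((\beta,j),(\beta',j'))=1$ iff $B(j,j')B_n(\beta,\beta')=1$, for $(n+1)\times 1$ blocks $(\beta,j),(\beta',j')$ occurring in $X(A,B)$ (here $\beta,\beta'$ are $n\times 1$ blocks and $j,j'\in S$). A configuration on $K_n$ is viewed as a one-sided sequence (indexed by $i$) of $1\times n$ blocks, and a configuration on $L_n$ as a one-sided sequence (indexed by $j$) of $n\times 1$ blocks. The one-dimensional Markov shift with finite alphabet $Q$ and transition matrix $M\in\{0,1\}^{Q\times Q}$ is $\{(q_i)_{i\in\mathbb{N}}\in Q^{\mathbb{N}}: M(q_i,q_{i+1})=1\text{ for all }i\}$. For a $\{0,1\}$-matrix $M$ indexed by a finite set $Q$ with no zero rows, $\mathcal{O}_M$ is the universal $C^*$-algebra generated by partial isometries $(s_q)_{q\in Q}$ with $1=\sum_{q}s_qs_q^*$ and $s_q^*s_q=\sum_{q'}M(q,q')s_{q'}s_{q'}^*$. For a finite directed graph $E$ without sinks, $C^*(E)$ is the graph $C^*$-algebra, universal for mutually orthogonal projections $p_v$ ($v$ a vertex) and partial isometries $t_e$ ($e$ an edge) with $t_e^*t_e=p_{r(e)}$ and $p_v=\sum_{s(e)=v}t_et_e^*$;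 infinite paths are sequences of edges $x_1x_2\cdots$ with $r(x_i)=s(x_{i+1})$. *)

(* Defs.v *)
From HB Require Import structures.
From mathcomp Require Import all_boot all_order all_algebra.
From mathcomp Require Import complex.
From mathcomp Require Import all_classical all_reals all_analysis.

Set Implicit Arguments.
Unset Strict Implicit.
Unset Printing Implicit Defensive.

Import Order.TTheory GRing.Theory Num.Theory.
Import numFieldNormedType.Exports.

Local Open Scope classical_set_scope.
Local Open Scope ring_scope.

(* A C*-algebra need not have a unit, so the product is not taken from the
   library's (unital) ring structures.  The norm takes its values in the
   scalar field, as for every normedModType; K is meant to be R[i]. *)
HB.mixin Record CompleteNormedModule_isCStar (K : numClosedFieldType) T
    of CompleteNormedModule K T := {
  cmul : T -> T -> T;
  cstar : T -> T;
  cmulA : associative cmul;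
  cmulDl : left_distributive cmul +%R;
  cmulDr : right_distributive cmul +%R;
  cscalerAl : forall (a : K) (x y : T), a *: cmul x y = cmul (a *: x) y;
  cscalerAr : forall (a : K) (x y : T), a *: cmul x y = cmul x (a *: y);
  cstarK : involutive cstar;
  cstarD : {morph cstar : x y / x + y};
  cstarZ : forall (a : K) (x : T), cstar (a *: x) = a^* *: cstar x;
  cstarM : forall x y : T, cstar (cmul x y) = cmul (cstar y) (cstar x);
  cnormM : forall x y : T, `|cmul x y| <= `|x| * `|y|;
  cnorm_starM : forall x : T, `|cmul (cstar x) x| = `|x| ^+ 2
}.

#[short(type="cstarAlgType")]
HB.structure Definition CStarAlgebra (K : numClosedFieldType) :=
  {T of CompleteNormedModule_isCStar K T & CompleteNormedModule K T}.

Declare Scope cstar_scope.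
Delimit Scope cstar_scope with CS.
Notation "x ** y" := (cmul x y) (at level 40, left associativity) : cstar_scope.
Notation "x ^#" := (cstar x) (at level 2, format "x ^#") : cstar_scope.
Local Open Scope cstar_scope.

Section CStarTheory.
Variable K : numClosedFieldType.

Definition star_hom (U V : cstarAlgType K) (f : U -> V) : Prop :=
  [/\ forall (a : K) (x y : U), f (a *: x + y) = a *: f x + f y,
      forall x y : U, f (x ** y) = f x ** f y
    & forall x : U, f (x^#) = (f x)^#].

Definition star_isomorphic (U V : cstarAlgType K) : Prop :=
  exists2 f : U -> V, star_hom f & bijective f.

Definition star_subalgebra (U : cstarAlgType K) (P : set U) : Prop :=
  [/\ P 0,
      forall (a : K) (x y : U), P x -> P y -> P (a *: x + y),
      forall x y : U, P x -> P y -> P (x ** y)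
    & forall x : U, P x -> P (x^#)].

Definition generates (U : cstarAlgType K) (G : set U) : Prop :=
  forall P : set U, star_subalgebra P -> closed P -> G `<=` P -> P = setT.

Definition projection (U : cstarAlgType K) (p : U) : Prop :=
  p ** p = p /\ p^# = p.

Definition partial_isometry (U : cstarAlgType K) (s : U) : Prop :=
  s ** s^# ** s = s.

Definition is_unit (U : cstarAlgType K) (e : U) : Prop :=
  forall x : U, e ** x = x /\ x ** e = x.

Definition CK_family (Q : finType) (M : Q -> Q -> nat)
    (U : cstarAlgType K) (s : Q -> U) : Prop :=
  [/\ forall q, partial_isometry (s q),
      is_unit (\sum_q s q ** (s q)^#)
    & forall q, (s q)^# ** s q = \sum_q' (s q' ** (s q')^#) *+ M q q'].

(* U is (a realization of) the Cuntz-Krieger algebra O_M.  Homomorphisms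
   are not asked to preserve units, but here they do as the unit is a
   polynomial in the generators. *)
Definition is_CK_algebra (Q : finType) (M : Q -> Q -> nat)
    (U : cstarAlgType K) : Prop :=
  exists s : Q -> U,
    [/\ CK_family M s,
        generates (range s)
      & forall (V : cstarAlgType K) (s' : Q -> V), CK_family M s' ->
          exists2 f : U -> V, star_hom f & forall q, f (s q) = s' q].

Record digraph := Digraph {
  vertex : finType;
  edge : finType;
  source : edge -> vertex;
  target : edge -> vertex
}.

Definition graph_family (E : digraph) (U : cstarAlgType K)
    (p : vertex E -> U) (t : edge E -> U) : Prop :=
  [/\ forall v, projection (p v),
      forall v w, v != w -> p v ** p w = 0,
      forall e, partial_isometry (t e),
      forall e, (t e)^# ** t e = p (target e)
    & forall v, p v = \sum_(e | source e == v) t e ** (t e)^#].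

(* U is (a realization of) the graph algebra C*(E). *)
Definition is_graph_algebra (E : digraph) (U : cstarAlgType K) : Prop :=
  exists (p : vertex E -> U) (t : edge E -> U),
    [/\ graph_family p t,
        generates (range p `|` range t)
      & forall (V : cstarAlgType K) (p' : vertex E -> V) (t' : edge E -> V),
          graph_family p' t' ->
          exists f : U -> V,
            [/\ star_hom f, forall v, f (p v) = p' v
              & forall e, f (t e) = t' e]].

End CStarTheory.

Section MatrixShift.
Variable k : nat.
Implicit Types A B : 'M[nat]_k.

Definition transition_matrix A : Prop :=
  [/\ forall i j, A i j = 0%N \/ A i j = 1%N,
      forall i, exists j, A i j <> 0%N
    & forall j, exists i, A i j <> 0%N].

Definition coherent A B : Prop :=
  (forall i j, (0 < (A *m B) i j)%N <-> (0 < (B *m A) i j)%N) /\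
  (forall i j, (0 < (A *m B^T) i j)%N <-> (0 < (B^T *m A) i j)%N).

(* x i j is the symbol in column i (counted rightwards) and row j (counted
   upwards). *)
Definition matrix_shift A B : set (nat -> nat -> 'I_k) :=
  [set x | forall i j, A (x i j) (x i.+1 j) = 1%N /\
                       B (x i j) (x i j.+1) = 1%N].

(* Arrays of width m and height n, with arguments (column, row). *)
Definition pattern (m n : nat) := {ffun 'I_m * 'I_n -> 'I_k}.

Definition window (x : nat -> nat -> 'I_k) (a b m n : nat) : pattern m n :=
  [ffun ij : 'I_m * 'I_n => x (a + ij.1)%N (b + ij.2)%N].

Definition occurs A B m n (u : pattern m n) : Prop :=
  exists x a b, matrix_shift A B x /\ u = window x a b m n.

Definition block A B m n := {u : pattern m n | `[< occurs A B u >]}.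

Definition left_part m n (u : pattern m n) : pattern m.-1 n :=
  [ffun ij => u (widen_ord (leq_pred m) ij.1, ij.2)].

Definition lower_part m n (u : pattern m n) : pattern m n.-1 :=
  [ffun ij => u (ij.1, widen_ord (leq_pred n) ij.2)].

Lemma succ_subproof n (i : 'I_n.-1) : (i.+1 < n)%N.
Proof. by case: n i => [[]|n] // i; rewrite ltnS. Qed.

Definition succ_ord n (i : 'I_n.-1) : 'I_n := Ordinal (succ_subproof i).

Definition right_part m n (u : pattern m n) : pattern m.-1 n :=
  [ffun ij => u (succ_ord ij.1, ij.2)].

Definition upper_part m n (u : pattern m n) : pattern m n.-1 :=
  [ffun ij => u (ij.1, succ_ord ij.2)].

Section Blocks.
Variables A B : 'M[nat]_k.

Lemma left_part_occurs m n (u : block A B m n) :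
  `[< occurs A B (left_part (val u)) >].
Proof.
case: u => u /= /asboolP[x [a [b [Xx ->]]]]; apply/asboolP.
by exists x, a, b; split=> //; apply/ffunP => ij; rewrite !ffunE.
Qed.

Lemma lower_part_occurs m n (u : block A B m n) :
  `[< occurs A B (lower_part (val u)) >].
Proof.
case: u => u /= /asboolP[x [a [b [Xx ->]]]]; apply/asboolP.
by exists x, a, b; split=> //; apply/ffunP => ij; rewrite !ffunE.
Qed.

Lemma right_part_occurs m n (u : block A B m n) :
  `[< occurs A B (right_part (val u)) >].
Proof.
case: u => u /= /asboolP[x [a [b [Xx ->]]]]; apply/asboolP.
by exists x, a.+1, b; split=> //; apply/ffunP => ij; rewrite !ffunE /= addSnnS.
Qed.

Lemma upper_part_occurs m n (u : block A B m n) :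
  `[< occurs A B (upper_part (val u)) >].
Proof.
case: u => u /= /asboolP[x [a [b [Xx ->]]]]; apply/asboolP.
by exists x, a, b.+1; split=> //; apply/ffunP => ij; rewrite !ffunE /= addSnnS.
Qed.

Definition left_block m n (u : block A B m n) : block A B m.-1 n :=
  Sub (left_part (val u)) (left_part_occurs u).
Definition lower_block m n (u : block A B m n) : block A B m n.-1 :=
  Sub (lower_part (val u)) (lower_part_occurs u).
Definition right_block m n (u : block A B m n) : block A B m.-1 n :=
  Sub (right_part (val u)) (right_part_occurs u).
Definition upper_block m n (u : block A B m n) : block A B m n.-1 :=
  Sub (upper_part (val u)) (upper_part_occurs u).

(* Meant for 1 <= m and 2 <= n. *)
Definition graphG m n : digraph :=
  @Digraph (block A B m n.-1) (block A B m n)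
    (@lower_block m n) (@upper_block m n).

(* Meant for 2 <= m and 1 <= n. *)
Definition graphGbar m n : digraph :=
  @Digraph (block A B m.-1 n) (block A B m n)
    (@left_block m n) (@right_block m n).

(* The matrices A_n and B_n, for 1 <= n (0 is a junk value); a 1 x 1 block is
   identified with its symbol.  The last row of a 1 x n.+1 block carries its
   top symbol, the last column of an n.+1 x 1 block its rightmost symbol. *)
Definition matA_step n (M : block A B 1 n -> block A B 1 n -> nat)
    (u u' : block A B 1 n.+1) : nat :=
  if (A (val u (ord0, ord_max)) (val u' (ord0, ord_max)) *
      M (lower_block u) (lower_block u') == 1)%N then 1 else 0.

Fixpoint matA n : block A B 1 n -> block A B 1 n -> nat :=
  match n with
  | 0 => fun _ _ => 0%N
  | n1.+1 =>
      match n1 return (block A B 1 n1 -> block A B 1 n1 -> nat) ->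
                      block A B 1 n1.+1 -> block A B 1 n1.+1 -> nat with
      | 0 => fun _ u u' => A (val u (ord0, ord0)) (val u' (ord0, ord0))
      | _.+1 => @matA_step _
      end (@matA n1)
  end.

Definition matB_step n (M : block A B n 1 -> block A B n 1 -> nat)
    (u u' : block A B n.+1 1) : nat :=
  if (B (val u (ord_max, ord0)) (val u' (ord_max, ord0)) *
      M (left_block u) (left_block u') == 1)%N then 1 else 0.

Fixpoint matB n : block A B n 1 -> block A B n 1 -> nat :=
  match n with
  | 0 => fun _ _ => 0%N
  | n1.+1 =>
      match n1 return (block A B n1 1 -> block A B n1 1 -> nat) ->
                      block A B n1.+1 1 -> block A B n1.+1 1 -> nat with
      | 0 => fun _ u u' => B (val u (ord0, ord0)) (val u' (ord0, ord0))
      | _.+1 => @matB_step _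
      end (@matB n1)
  end.

(* Restrictions of points of X(A,B) to K_n = {(i,j) | j < n}, seen as
   sequences of 1 x n blocks (columns). *)
Definition shiftY_A n : set (nat -> block A B 1 n) :=
  [set y | exists2 x, matrix_shift A B x &
             forall i, val (y i) = window x i 0 1 n].

(* Restrictions of points of X(A,B) to L_n = {(i,j) | i < n}, seen as
   sequences of n x 1 blocks (rows). *)
Definition shiftY_B n : set (nat -> block A B n 1) :=
  [set y | exists2 x, matrix_shift A B x &
             forall j, val (y j) = window x 0 j n 1].

End Blocks.
End MatrixShift.

Arguments matA {k} A B n u u' : rename.
Arguments matB {k} A B n u u' : rename.
Arguments shiftY_A {k} A B n : rename.
Arguments shiftY_B {k} A B n : rename.

Definition markov_shift (Q : finType) (M : Q -> Q -> nat) : set (nat -> Q) :=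
  [set y | forall i, M (y i) (y i.+1) = 1%N].

(* Main.v *)
Require Import Defs.
From mathcomp Require Import all_boot all_order all_algebra.
From mathcomp Require Import complex.
From mathcomp Require Import all_classical all_reals all_analysis.

(** Two one-dimensional pictures of a strip of X(A,B) are compared: its columns,
    with transition matrix A_n, and its blocks of width 2, which are the edges
    of a graph on the columns.  They agree as soon as every locally admissible
    strip is a restriction of a point of X(A,B).  This is where coherence
    enters: the relation between A B^t and B^t A says that the upper right
    corner of a unit square can be filled whenever its other three corners are
    compatible, so that a row can be continued by a row above it
    ([extend_row_up]) and a strip by a point of the shift ([extend_strip_up]).
    The statements about Y(A_n) follow at once, and A_n(v,w) is seen to be the
    number of edges from v to w ([matA_edge]).  The statements about B_n follow
    by exchanging A with B and the two directions, which preserves coherence.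

    It remains to see that C*(E) and O_M are isomorphic when E is a finite graph
    without multiple edges and M is its vertex matrix ([graph_algebra_iso_CK]).
    Mutually inverse homomorphisms come from the universal properties:
    s_v = sum of the t_e over the edges e leaving v, and conversely
    p_v = s_v s_v^*, t_e = s_v p_w for an edge e from v to w.  Three facts about
    C*-algebras are used in passing.

    - The composites fix the generators; they are the identity because a
      *-homomorphism is contractive, hence continuous ([star_hom_contractive]).
      If a is self-adjoint of norm less than 1, then
      a + i (1 - a^2)^(1/2) is unitary, and so is its image, of which the image
      of a is the real part.

    - Projections whose sum is a projection are mutually orthogonal
      ([projection_sum_orthogonal]).  The Cuntz-Krieger relations do not contain
      the orthogonality of the ranges s_v s_v^*, nor the graph relations that of
      the t_e t_e^*.  Cutting down to the corner of one of the projections, this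
      becomes the statement that an element b is 0 when b and - b are positive;
      there positivity of b can be read off from norms, as |t - b| <= t, and b
      vanishes because b + epsilon and - b + epsilon have square roots.

    - Both facts need the square root of 1 - x for |x| < 1.  Writing it as
      1 - y, the equation to solve is 2 y = x + y^2, and y is the fixed point of
      a contraction ([half_square_fixpoint]).  It is a limit of polynomials in x
      without constant term, which keeps the argument inside algebras that have
      no unit. *)

Set Implicit Arguments.
Unset Strict Implicit.
Unset Printing Implicit Defensive.

Import Order.TTheory GRing.Theory Num.Theory.
Import numFieldNormedType.Exports.

Local Open Scope classical_set_scope.
Local Open Scope cstar_scope.
Local Open Scope ring_scope.

(** * Arithmetic in C*-algebras *)

Section CStarArithmetic.
Variables (K : numClosedFieldType) (U : cstarAlgType K).
Implicit Types (x y z : U) (P : set U).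

Lemma cmul0l x : 0 ** x = 0.
Proof. by apply: (addrI (0 ** x)); rewrite -cmulDl !addr0. Qed.

Lemma cmul0r x : x ** 0 = 0.
Proof. by apply: (addrI (x ** 0)); rewrite -cmulDr !addr0. Qed.

Lemma cmulNl x y : (- x) ** y = - (x ** y).
Proof. by apply/eqP; rewrite -addr_eq0 -cmulDl addNr cmul0l. Qed.

Lemma cmulNr x y : x ** (- y) = - (x ** y).
Proof. by apply/eqP; rewrite -addr_eq0 -cmulDr addNr cmul0r. Qed.

Lemma cmulBl x y z : (x - y) ** z = x ** z - y ** z.
Proof. by rewrite cmulDl cmulNl. Qed.

Lemma cmulBr x y z : z ** (x - y) = z ** x - z ** y.
Proof. by rewrite cmulDr cmulNr. Qed.

Lemma cmulZl (a : K) x y : (a *: x) ** y = a *: (x ** y).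
Proof. by rewrite cscalerAl. Qed.

Lemma cmulZr (a : K) x y : x ** (a *: y) = a *: (x ** y).
Proof. by rewrite cscalerAr. Qed.

Lemma cmul_suml (I : Type) (r : seq I) (Q : pred I) (F : I -> U) y :
  (\sum_(i <- r | Q i) F i) ** y = \sum_(i <- r | Q i) F i ** y.
Proof. exact: (big_morph (cmul^~ y) (fun a b => cmulDl a b y) (cmul0l y)). Qed.

Lemma cmul_sumr (I : Type) (r : seq I) (Q : pred I) (F : I -> U) y :
  y ** (\sum_(i <- r | Q i) F i) = \sum_(i <- r | Q i) y ** F i.
Proof. exact: (big_morph (cmul y) (fun a b => cmulDr y a b) (cmul0r y)). Qed.

Lemma cstar0 : (0 : U)^# = 0.
Proof. by apply: (addrI (0^#)); rewrite -cstarD !addr0. Qed.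

Lemma cstarN x : (- x)^# = - x^#.
Proof. by apply/eqP; rewrite -addr_eq0 -cstarD addNr cstar0. Qed.

Lemma cstarB x y : (x - y)^# = x^# - y^#.
Proof. by rewrite cstarD cstarN. Qed.

Lemma cstar_sum (I : Type) (r : seq I) (Q : pred I) (F : I -> U) :
  (\sum_(i <- r | Q i) F i)^# = \sum_(i <- r | Q i) (F i)^#.
Proof. exact: (big_morph (@cstar K U) (@cstarD K U) cstar0). Qed.

Lemma cnorm_star x : `|x^#| = `|x|.
Proof.
have le z : `|z| <= `|z^#|.
  have [->|z0] := eqVneq z 0; first by rewrite cstar0.
  rewrite -(@ler_pM2r _ `|z|) ?normr_gt0 // -expr2 -cnorm_starM.
  exact: cnormM.
by apply/eqP; rewrite eq_le le andbT -{2}(cstarK x) le.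
Qed.

Lemma cnorm_selfadjoint x : x^# = x -> `|x ** x| = `|x| ^+ 2.
Proof. by move=> {1}<-; rewrite cnorm_starM. Qed.

Lemma cstar_mul_eq0 x : x^# ** x = 0 -> x = 0.
Proof.
move=> x0; apply/eqP; rewrite -normr_eq0 -sqrf_eq0.
by rewrite -cnorm_starM x0 normr0.
Qed.

Lemma projection_mul_star x : partial_isometry x -> projection (x ** x^#).
Proof.
move=> px; split; last by rewrite cstarM cstarK.
by rewrite cmulA px.
Qed.

Lemma partial_isometry_star x : partial_isometry x -> x^# ** x ** x^# = x^#.
Proof. by move=> px; rewrite -{4}px !cstarM cstarK cmulA. Qed.

(** All the closed sets below are equalizers of two bounded additive maps, for
    instance of left and right multiplication by an element. *)
Lemma closed_equalizer (V : cstarAlgType K) (f g : U -> V) (c d : K) :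
    0 <= c -> (forall x, `|f x| <= c * `|x|) ->
    0 <= d -> (forall x, `|g x| <= d * `|x|) ->
    {morph f : x y / x - y} -> {morph g : x y / x - y} ->
  closed [set x | f x = g x].
Proof.
move=> c0 lf d0 lg fB gB x clx /=; apply/eqP; rewrite -subr_eq0 -normr_eq0.
rewrite eq_le normr_ge0 andbT; apply/ler_addgt0Pr => e e0; rewrite add0r.
have cd0 : 0 < c + d + 1 by rewrite ltr_wpDl ?addr_ge0 ?ltr01.
have [y [/= fgy]] := clx _ (nbhsx_ballx x _ (divr_gt0 e0 cd0)).
rewrite -ball_normE /= => xy.
have -> : f x - g x = f (x - y) - g (x - y).
  by rewrite fB gB fgy opprB addrA subrK.
apply: (le_trans (ler_normB _ _)).
apply: (le_trans (lerD (lf _) (lg _))).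
rewrite -mulrDl (@le_trans _ _ ((c + d + 1) * `|x - y|)) //.
  by rewrite ler_wpM2r // lerDl ler01.
by rewrite mulrC -ler_pdivlMr // ltW.
Qed.

Lemma closed_commutant (a : U) : closed [set x | a ** x = x ** a].
Proof.
apply: (@closed_equalizer _ _ _ `|a| `|a|) => // x.
- exact: cnormM.
- by rewrite mulrC cnormM.
- by move=> y; rewrite cmulBr.
- by move=> y; rewrite cmulBl.
Qed.

Lemma closed_left_unit (e : U) : closed [set x | e ** x = x].
Proof.
apply: (@closed_equalizer _ _ _ `|e| 1) => // x.
- exact: cnormM.
- by rewrite mul1r.
- by move=> y; rewrite cmulBr.
Qed.

Lemma closed_right_unit (e : U) : closed [set x | x ** e = x].
Proof.
apply: (@closed_equalizer _ _ _ `|e| 1) => // x.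
- by rewrite mulrC cnormM.
- by rewrite mul1r.
- by move=> y; rewrite cmulBl.
Qed.

Lemma closed_selfadjoint : closed [set x : U | x^# = x].
Proof.
apply: (@closed_equalizer _ _ _ 1 1) => // x.
- by rewrite mul1r cnorm_star.
- by rewrite mul1r.
- by move=> y; rewrite cstarB.
Qed.

End CStarArithmetic.

(** * Square roots by a fixed point *)

Section FixedPoint.
Variable R : realType.
Local Notation K := R[i].

(** Norms take their values in the partially ordered field R[i]; the decay of
    geometric sequences is checked on its real axis. *)
Lemma complex_geometric_small (r e : K) : 0 <= r -> r < 1 -> 0 < e ->
  exists n, forall m, (n <= m)%N -> r ^+ m < e.
Proof.
move=> r0 r1 e0.
have rE : r = ((complex.Re r)%:C)%C by rewrite RRe_real // ger0_real.
have eE : e = ((complex.Re e)%:C)%C by rewrite RRe_real // gtr0_real.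
move: r0 r1 e0; rewrite rE eE; move: (complex.Re r) (complex.Re e) => s d.
rewrite (lecR 0) (ltcR _ 1) (ltcR 0) => s0 s1 d0.
have s1' : `|s| < 1 by rewrite ger0_norm.
have [n _ Hn] := (cvgrPdist_lt _ _).1 (cvg_expr s1') _ d0.
exists n => m nm; rewrite -rmorphXn ltcR.
by have := Hn m nm; rewrite /= sub0r normrN ger0_norm ?exprn_ge0.
Qed.

Variable U : cstarAlgType K.
Implicit Types (x y z : U).

(** The solution y = 1 - (1 - x)^(1/2) is a limit of polynomials in x without
    constant term.  The last clause is the induction principle that this gives:
    y inherits every closed property that passes along the iteration
    z |-> (x + z^2) / 2 from 0, such as being self-adjoint or commuting with a
    given element. *)
Lemma half_square_fixpoint x (r : K) : r < 1 -> `|x| <= r ->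
  exists y, y + y = x + y ** y /\
    forall P : set U, closed P -> P 0 ->
      (forall z, P z -> P (2^-1 *: (x + z ** z))) -> P y.
Proof.
move=> r1 xr; pose phi z := 2^-1 *: (x + z ** z); pose u n := iter n phi 0.
have r0 : 0 <= r by apply: le_trans xr.
have i2 : `|2^-1 : K| = 2^-1 by rewrite ger0_norm ?invr_ge0 ?ler0n.
have half2 (z : U) : 2^-1 *: (z + z) = z.
  by rewrite -mulr2n -(@scaler_nat K U) scalerA mulVf ?pnatr_eq0 // scale1r.
have half_le (z : U) t : `|z| <= t + t -> `|2^-1 *: z| <= t.
  move=> zt; rewrite normrZ i2 mulrC ler_pdivrMr ?ltr0n //.
  by rewrite mulr_natr mulr2n.
have contr y z : `|y| <= r -> `|z| <= r -> `|phi y - phi z| <= r * `|y - z|.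
  move=> yr zr; rewrite -scalerBr; apply: half_le.
  have -> : x + y ** y - (x + z ** z) = y ** (y - z) + (y - z) ** z.
    by rewrite cmulBr cmulBl addrA subrK opprD addrACA subrr add0r.
  apply: (le_trans (ler_normD _ _)); apply: lerD.
    by apply: (le_trans (cnormM _ _)); rewrite ler_wpM2r.
  by apply: (le_trans (cnormM _ _)); rewrite mulrC ler_wpM2r.
have ur n : `|u n| <= r.
  elim: n => [|n IH]; first by rewrite normr0.
  apply: half_le; apply: (le_trans (ler_normD _ _)); apply: lerD => //.
  apply: (le_trans (cnormM _ _)); apply: (le_trans (ler_pM _ _ IH IH)) => //.
  by rewrite -[leRHS]mulr1 ler_wpM2l // ltW.
have uc n d : `|u (n + d)%N - u n| <= r ^+ n.
  elim: n => [|n IH].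
    by rewrite subr0 expr0 (le_trans (ur _)) // ltW.
  by rewrite exprS (le_trans (contr _ _ (ur _) (ur _))) // ler_wpM2l.
have /cauchy_cvgP/cvg_ex[y uy] : cauchy (u @ \oo).
  apply: cauchy_exP => e e0; have [n Hn] := complex_geometric_small r0 r1 e0.
  exists (u n), n => // m /= nm; rewrite -ball_normE /= distrC.
  by rewrite -(subnKC nm) (le_lt_trans (uc _ _)) // Hn.
have uy_lt e : 0 < e -> exists n, forall m, (n <= m)%N -> `|y - u m| < e.
  by move=> /((cvgrPdist_lt _ _).1 uy)[n _ Hn]; exists n => m /Hn.
have yr : `|y| <= r.
  apply/ler_addgt0Pr => e /uy_lt[n /(_ n (leqnn n)) Hn].
  rewrite -(subrK (u n) y) (le_trans (ler_normD _ _)) // addrC lerD //.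
  exact: ltW.
have yE : phi y = y.
  apply/eqP; rewrite -subr_eq0 -normr_eq0 eq_le normr_ge0 andbT.
  apply/ler_addgt0Pr => e e0; rewrite add0r.
  have [n Hn] := uy_lt (e / 2) (divr_gt0 e0 (ltr0n _ 2)).
  rewrite -(subrK (u n.+1) (phi y)) -addrA (splitr e).
  apply: (le_trans (ler_normD _ _)); apply: lerD.
    apply: (le_trans (contr _ _ yr (ur _))).
    apply: le_trans (ltW (Hn n _)) => //.
    by rewrite ler_piMl // ltW.
  by rewrite distrC ltW // Hn.
exists y; split.
  by rewrite -{1 2}yE -scalerDr half2.
move=> P Pc P0 Pphi; apply: (closed_cvg _ Pc _ _ uy).
by exists 0%N => // n _ /=; elim: n => [|n IH] //=; exact: Pphi.
Qed.

End FixedPoint.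

(** * Norm estimates for self-adjoint elements and projections *)

Section Unitary.
Variables (K : numClosedFieldType) (U : cstarAlgType K).
Implicit Types (x y z a b c d e p q : U).

Lemma half_norm_le z (t : K) : `|z + z| <= t + t -> `|z| <= t.
Proof.
by rewrite -mulr2n normrMn -mulr2n lerMn2r.
Qed.

Lemma conjCi_mul : ('i : K)^* * 'i = 1.
Proof. by rewrite conjCi mulNr -expr2 sqrCi opprK. Qed.

(** The hypothesis says that a^2 + (1 - y)^2 = 1, so that a + i (1 - y) and its
    adjoint a - i (1 - y) are unitary in the unitization.  Their products with
    an element z still make sense here and have the norm of z, and a z is the
    mean of these two products. *)
Lemma selfadjoint_norm_le a y :
  a^# = a -> y^# = y -> a ** y = y ** a -> y + y = a ** a + y ** y -> `|a| <= 1.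
Proof.
move=> asa ysa ay yE; pose u (l : K) z := a ** z + l *: (z - y ** z).
have uP (l : K) z : l^* = - l -> l^* * l = 1 -> `|u l z| = `|z|.
  move=> lN l1; apply/eqP; rewrite -(@eqrXn2 _ 2) // -!cnorm_starM.
  apply/eqP; congr (`| _ |); rewrite /u cstarD cstarZ.
  set v := z - y ** z.
  have cross : (a ** z)^# ** v = v^# ** (a ** z).
    rewrite cstarB !cstarM asa ysa cmulBr cmulBl !cmulA; congr (_ - _).
    by rewrite -(cmulA _ a) ay cmulA.
  rewrite cmulDr !cmulDl !cmulZl !cmulZr.
  rewrite scalerA l1 scale1r cross lN.
  rewrite addrA -(addrA (_ ** _)) scaleNr addNr addr0.
  have -> : v^# ** v = z^# ** (z - (y ** z + y ** z) + y ** (y ** z)).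
    rewrite cstarB cmulBl !cstarM ysa -!cmulA -cmulBr; congr (_ ** _).
    by rewrite /v cmulBr opprB opprD !addrA [in RHS]addrAC.
  rewrite cstarM asa -!cmulA -cmulDr -cmulDl yE cmulDl -!cmulA opprD.
  by rewrite (addrA z) subrK addrCA subrr addr0.
have az z : `|a ** z| <= `|z|.
  apply: half_norm_le.
  have -> : a ** z + a ** z = u 'i z + u (- 'i) z.
    by rewrite /u scaleNr addrACA subrr addr0.
  apply: (le_trans (ler_normD _ _)); apply: lerD; rewrite uP //.
  - by rewrite conjCi.
  - exact: conjCi_mul.
  - by rewrite raddfN /= conjCi.
  - by rewrite raddfN /= mulrNN conjCi_mul.
(* The choice z = a gives |a|^2 <= |a|. *)
have [->|a0] := eqVneq a 0; first by rewrite normr0 ler01.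
have := az a; rewrite cnorm_selfadjoint // expr2.
by rewrite -ler_pdivlMr ?normr_gt0 // divff // normr_eq0.
Qed.

(** The sum is w^* w for w = c + i d, and c is the real part of w.  For
    commuting squares this replaces the theorem that a sum of positive elements
    dominates each of them. *)
Lemma norm_le_sum_squares c d :
  c^# = c -> d^# = d -> c ** d = d ** c -> `|c| ^+ 2 <= `|c ** c + d ** d|.
Proof.
move=> csa dsa cd; pose w := c + 'i *: d.
have wE : w^# = c - 'i *: d by rewrite cstarD cstarZ conjCi csa dsa scaleNr.
have -> : c ** c + d ** d = w^# ** w.
  rewrite wE cmulBl !cmulDr !cmulZl !cmulZr cd scalerA -expr2 sqrCi scaleN1r.
  by rewrite opprD opprK addrA addrK.
rewrite cnorm_starM lerXn2r ?nnegrE //; apply: half_norm_le.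
have -> : c + c = w + w^# by rewrite wE addrACA subrr addr0.
by apply: (le_trans (ler_normD _ _)); rewrite cnorm_star.
Qed.

Lemma projection_norm_le1 e : projection e -> `|e| <= 1.
Proof.
move=> [ee esa]; have [->|e0] := eqVneq e 0; first by rewrite normr0 ler01.
have /eqP := cnorm_selfadjoint esa; rewrite ee expr2.
by rewrite -{1}[`|e|]mulr1 (inj_eq (mulfI _)) ?normr_eq0 // => /eqP <-.
Qed.

(** In the corner of e, the element e q e is positive: its distance to the unit
    is at most 1.  With y = (1 - q) e the left-hand side is the norm of both
    y^* y and e y, hence |y|^2 <= |y|. *)
Lemma projection_corner_norm_le1 e q :
  projection e -> projection q -> `|e - e ** q ** e| <= 1.
Proof.
move=> [ee esa] [qq qsa]; pose y := e - q ** e.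
have ey : e ** y = e - e ** q ** e by rewrite cmulBr ee cmulA.
have yy : y^# ** y = e - e ** q ** e.
  rewrite cstarB cstarM esa qsa cmulBl ey /y cmulBr cmulA -(cmulA e q q) qq.
  by rewrite subrr subr0.
have [y0|y0] := eqVneq y 0; first by rewrite -ey y0 cmul0r normr0 ler01.
have y1 : `|y| <= 1.
  rewrite -(@ler_pM2r _ `|y|) ?normr_gt0 // mul1r -expr2 -cnorm_starM yy -ey.
  apply: (le_trans (cnormM _ _)); rewrite ler_piMl //.
  exact: projection_norm_le1.
by rewrite -yy cnorm_starM expr_le1.
Qed.

End Unitary.

(** * Continuity of *-homomorphisms *)

Section StarHom.
Variables (K : numClosedFieldType) (U V W : cstarAlgType K) (f : U -> V).
Hypothesis fP : star_hom f.

Lemma star_homM x y : f (x ** y) = f x ** f y. Proof. by case: fP. Qed.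
Lemma star_hom_star x : f x^# = (f x)^#. Proof. by case: fP. Qed.

Lemma star_homD x y : f (x + y) = f x + f y.
Proof. by case: fP => fl _ _; have := fl 1 x y; rewrite !scale1r. Qed.

Lemma star_hom0 : f 0 = 0.
Proof. by apply: (addrI (f 0)); rewrite -star_homD !addr0. Qed.

Lemma star_homZ (a : K) x : f (a *: x) = a *: f x.
Proof. by case: fP => fl _ _; have := fl a x 0; rewrite star_hom0 !addr0. Qed.

Lemma star_homB x y : f (x - y) = f x - f y.
Proof. by rewrite -scaleN1r star_homD star_homZ scaleN1r. Qed.

Lemma star_hom_sum (I : Type) (r : seq I) (Q : pred I) (F : I -> U) :
  f (\sum_(i <- r | Q i) F i) = \sum_(i <- r | Q i) f (F i).
Proof. exact: (big_morph f star_homD star_hom0). Qed.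

Lemma star_hom_comp (g : V -> W) : star_hom g -> star_hom (g \o f).
Proof.
case: fP => fl fm fs [gl gm gs]; split=> [a x y|x y|x] /=.
- by rewrite fl gl.
- by rewrite fm gm.
- by rewrite fs gs.
Qed.

End StarHom.

Section Contraction.
Variable R : realType.
Local Notation K := R[i].

(** The relation 2 y = a^2 + y^2, which makes a + i (1 - y) unitary, is preserved
    by homomorphisms. *)
Lemma star_hom_selfadjoint_le1 (U V : cstarAlgType K) (f : U -> V) (a : U) :
  star_hom f -> a^# = a -> `|a| < 1 -> `|f a| <= 1.
Proof.
move=> fP asa a1.
have aa : `|a ** a| <= `|a|.
  by apply: (le_trans (cnormM _ _)); rewrite ler_piMl // ltW.
have [y [yE yP]] := half_square_fixpoint a1 aa.
have [ysa ay] : [set z | z^# = z] y /\ [set z | a ** z = z ** a] y.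
  apply: (yP ([set z | z^# = z] `&` [set z | a ** z = z ** a])).
  - by apply: closedI; [exact: closed_selfadjoint|exact: closed_commutant].
  - by split; rewrite /= ?cstar0 // cmul0l cmul0r.
  - move=> z [/= zsa az]; split.
      by rewrite cstarZ cstarD !cstarM asa zsa geC0_conj // invr_ge0 ler0n.
    rewrite cmulZl cmulZr cmulDl cmulDr !cmulA; congr (_ *: (_ + _)).
    by rewrite az -!cmulA az.
apply: (@selfadjoint_norm_le _ _ _ (f y)).
- by rewrite -(star_hom_star fP) asa.
- by rewrite -(star_hom_star fP) ysa.
- by rewrite -!(star_homM fP) ay.
- by rewrite -!(star_homM fP) -!(star_homD fP) yE.
Qed.

(** The C*-identity reduces this to the self-adjoint elements x^* x. *)
Lemma star_hom_contractive (U V : cstarAlgType K) (f : U -> V) (x : U) :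
  star_hom f -> `|f x| <= `|x|.
Proof.
move=> fP; apply/ler_addgt0Pr => e e0.
have t0 : 0 < `|x| + e by rewrite ltr_wpDl.
have t0' : 0 < (`|x| + e)^-1 by rewrite invr_gt0.
pose z := (`|x| + e)^-1 *: x.
have z1 : `|z| < 1.
  by rewrite normrZ gtr0_norm // mulrC ltr_pdivrMr // mul1r ltrDl.
have : `|f z| ^+ 2 <= 1.
  rewrite -cnorm_starM -(star_hom_star fP) -(star_homM fP).
  apply: star_hom_selfadjoint_le1 => //; first by rewrite cstarM cstarK.
  by rewrite cnorm_starM expr_lt1.
rewrite expr_le1 // /z (star_homZ fP) normrZ gtr0_norm // mulrC.
by rewrite ler_pdivrMr // mul1r.
Qed.

Lemma closed_star_hom_fixed (U : cstarAlgType K) (f : U -> U) :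
  star_hom f -> closed [set x | f x = x].
Proof.
move=> fP; apply: (@closed_equalizer _ _ _ _ _ 1 1) => // [x|x|x y].
- by rewrite mul1r star_hom_contractive.
- by rewrite mul1r.
- exact: star_homB.
Qed.

(** This gives the uniqueness part of the universal properties, which assert
    only the existence of homomorphisms. *)
Lemma star_hom_fixes (U : cstarAlgType K) (f : U -> U) (G : set U) :
  star_hom f -> generates G -> (forall x, G x -> f x = x) -> forall x, f x = x.
Proof.
move=> fP Ggen fG x.
suff : [set x | f x = x] = setT by move=> /seteqP[_ /(_ x I)].
apply: Ggen => //; last exact: closed_star_hom_fixed.
split=> [|a y z|y z|y] /=.
- exact: star_hom0.
- by move=> fy fz; rewrite (star_homD fP) (star_homZ fP) fy fz.
- by move=> fy fz; rewrite (star_homM fP) fy fz.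
- by move=> fy; rewrite (star_hom_star fP) fy.
Qed.

End Contraction.

(** * Orthogonality of projections with a projection as sum *)

Section Corner.
Variable R : realType.
Local Notation K := R[i].
Variable U : cstarAlgType K.
Implicit Types (x y z a b c d e p q : U).

(** With e playing the part of the unit, c = e - y is a square root of e - x
    when 2 y = x + y^2.  That c commutes with whatever commutes with x makes the
    roots of two commuting elements commute. *)
Lemma corner_sqrt e x (r : K) :
    projection e -> e ** x = x -> x ** e = x -> x^# = x -> r < 1 -> `|x| <= r ->
  exists c, [/\ c^# = c, c ** c = e - x
    & forall a, a ** e = e ** a -> a ** x = x ** a -> a ** c = c ** a].
Proof.
move=> [ee esa] ex xe xsa r1 xr.
have [y [yE yP]] := half_square_fixpoint r1 xr.
have [[ey ye] ysa] : ([set z | e ** z = z] y /\ [set z | z ** e = z] y) /\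
    [set z | z^# = z] y.
  apply: (yP (([set z | e ** z = z] `&` [set z | z ** e = z]) `&`
              [set z | z^# = z])).
  - apply: closedI; last exact: closed_selfadjoint.
    by apply: closedI; [exact: closed_left_unit|exact: closed_right_unit].
  - by split; [split|]; rewrite /= ?cstar0 ?cmul0l ?cmul0r.
  - move=> z [[/= ez ze] zsa]; split; [split|].
    + by rewrite cmulZr cmulDr cmulA ez ex.
    + by rewrite cmulZl cmulDl -cmulA ze xe.
    + by rewrite cstarZ cstarD cstarM xsa zsa geC0_conj // invr_ge0 ler0n.
have yC a : a ** x = x ** a -> a ** y = y ** a.
  move=> ax; apply: (yP [set z | a ** z = z ** a]).
  - exact: closed_commutant.
  - by rewrite /= cmul0l cmul0r.
  - move=> z /= az; rewrite cmulZl cmulZr cmulDl cmulDr ax.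
    congr (_ *: (_ + _)).
    by rewrite cmulA az -!cmulA az.
exists (e - y); split.
- by rewrite cstarB esa ysa.
- rewrite cmulBl !cmulBr ee ey ye opprB addrA addrAC -(addrA e) -opprD.
  by rewrite yE opprD addrA subrK.
- by move=> a ae ax; rewrite cmulBr cmulBl ae yC.
Qed.

(** Both b and - b are positive in the corner of e.  For every epsilon > 0 and
    r = 1 / (1 + epsilon), the elements r (epsilon e + b) and
    r (epsilon e - b) of that corner are of the form e - x with |x| <= r < 1,
    and so have commuting self-adjoint square roots c and c'.  Then
    c^2 + c'^2 = 2 (1 - r) e is small, which makes c^2 small, and with it b. *)
Lemma corner_eq0_unit e b :
    projection e -> e ** b = b -> b ** e = b -> b^# = b ->
    `|e - b| <= 1 -> `|e + b| <= 1 ->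
  b = 0.
Proof.
move=> eP eb be bsa b1 b1'; have [ee esa] := eP.
apply/eqP; rewrite -normr_eq0 eq_le normr_ge0 andbT.
apply/ler_addgt0Pr => d d0; rewrite add0r.
(* The estimates below give |b| <= 3 epsilon. *)
pose s : K := 1 + d / 3; pose r := s^-1.
have d3 : 0 < d / 3 by rewrite divr_gt0 ?ltr0n.
have s0 : 0 < s by rewrite addr_gt0.
have r0 : 0 < r by rewrite invr_gt0.
have r1 : r < 1 by rewrite invf_lt1 // ltrDl.
have rsa (z : U) : z^# = z -> (r *: z)^# = r *: z.
  by move=> zsa; rewrite cstarZ zsa geC0_conj // ltW.
have rle (z : U) : `|z| <= 1 -> `|r *: z| <= r.
  by move=> z1; rewrite normrZ gtr0_norm // ler_piMr // ltW.
have [||||c [csa cE cC]] := @corner_sqrt e (r *: (e - b)) r eP _ _ _ r1.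
- by rewrite cmulZr cmulBr ee eb.
- by rewrite cmulZl cmulBl ee be.
- by rewrite rsa // cstarB esa bsa.
- exact: rle.
have [||||c' [csa' cE' cC']] := @corner_sqrt e (r *: (e + b)) r eP _ _ _ r1.
- by rewrite cmulZr cmulDr ee eb.
- by rewrite cmulZl cmulDl ee be.
- by rewrite rsa // cstarD esa bsa.
- exact: rle.
have ce : e ** c = c ** e.
  by apply: cC => //; rewrite cmulZr cmulZl cmulBr cmulBl ee eb be.
have cb : b ** c = c ** b.
  by apply: cC; rewrite ?eb ?be // cmulZr cmulZl cmulBr cmulBl eb be.
have cc' : c ** c' = c' ** c.
  by apply: cC' => //; rewrite cmulZr cmulZl cmulDr cmulDl ce cb.
have := norm_le_sum_squares csa csa' cc'.
rewrite -(cnorm_selfadjoint csa) cE cE'.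
have -> : e - r *: (e - b) + (e - r *: (e + b)) = ((1 - r) + (1 - r)) *: e.
  rewrite addrACA -opprD -scalerDr addrACA addNr addr0.
  by rewrite scalerDl scalerBl scale1r scalerDr addrACA opprD.
rewrite normrZ => le2.
have r1' : 0 <= 1 - r by rewrite subr_ge0 ltW.
have e1 := projection_norm_le1 eP.
have le3 : r * `|b| <= (1 - r) *+ 3.
  rewrite -(gtr0_norm r0) -normrZ gtr0_norm //.
  have -> : r *: b = (e - r *: (e - b)) - (1 - r) *: e.
    by rewrite scalerBr scalerBl scale1r [RHS]addrAC !subKr.
  apply: (le_trans (ler_normB _ _)); rewrite mulrSr; apply: lerD.
    apply: (le_trans le2); rewrite mulr2n ger0_norm; last exact: addr_ge0.
    by apply: ler_piMr => //; exact: addr_ge0.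
  by rewrite normrZ ger0_norm // ler_piMr.
have : `|b| <= s * ((1 - r) *+ 3).
  by rewrite -(@ler_pM2l _ r) // mulrA mulVf ?gt_eqF // mul1r.
move/le_trans; apply.
rewrite mulrnAr mulrBr mulr1 divff ?gt_eqF //.
by rewrite /s addrAC subrr add0r -mulr_natr divfK // pnatr_eq0.
Qed.

Lemma corner_eq0 e b (t : K) :
    projection e -> e ** b = b -> b ** e = b -> b^# = b -> 0 < t ->
    `|t *: e - b| <= t -> `|t *: e + b| <= t ->
  b = 0.
Proof.
move=> eP eb be bsa t0 tb tb'.
have sc (z : U) : `|z| <= t -> `|t^-1 *: z| <= 1.
  move=> zt; rewrite normrZ gtr0_norm ?invr_gt0 // mulrC.
  by rewrite ler_pdivrMr // mul1r.
have te : e = t^-1 *: (t *: e) by rewrite scalerA mulVf ?gt_eqF // scale1r.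
have : t^-1 *: b = 0.
  apply: (corner_eq0_unit eP).
  - by rewrite cmulZr eb.
  - by rewrite cmulZl be.
  - by rewrite cstarZ bsa geC0_conj // invr_ge0 ltW.
  - by rewrite {1}te -scalerBr sc.
  - by rewrite {1}te -scalerDr sc.
by move/eqP; rewrite scaler_eq0 invr_eq0 gt_eqF //= => /eqP.
Qed.

(** In the corner of e = q f the element b = e (q g) e is positive.  So is - b:
    expanding e p e over the sum p gives
    - b = (e - e p e) + sum of e (q i) e over the i other than f and g,
    a sum of positive terms.  Hence b = 0, which is (q g e)^* (q g e) = 0. *)
Lemma projection_sum_orthogonal (I : finType) (Q : pred I) (q : I -> U) :
    (forall i, Q i -> projection (q i)) -> projection (\sum_(i | Q i) q i) ->
  forall i j, Q i -> Q j -> i != j -> q i ** q j = 0.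
Proof.
move=> qP pP g f Qg Qf gf; set e := q f; set p := \sum_(i | Q i) q i in pP.
have eP : projection e := qP _ Qf; have [ee esa] := eP.
have [qgq qgsa] := qP _ Qg; have [pp psa] := pP.
pose b := e ** q g ** e.
suff b0 : b = 0.
  apply: cstar_mul_eq0; rewrite cstarM qgsa esa cmulA -(cmulA e) qgq.
  exact: b0.
pose rest := [pred i | Q i && (i != f) && (i != g)].
(* One unit for e - e p e and one for each remaining summand of - b. *)
pose t : K := 1 + \sum_(i | rest i) 1.
have t1 : 0 <= \sum_(i | rest i) (1 : K) by rewrite sumr_ge0.
have bE : e ** p ** e =
    e + (b + \sum_(i | rest i) e ** q i ** e).
  rewrite /p (bigD1 f) //= (bigD1 g) /=; last by rewrite Qg.
  by rewrite !cmulDr !cmulDl !ee cmul_sumr cmul_suml.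
have corner (i : I) : Q i -> `|e - e ** q i ** e| <= 1.
  by move=> Qi; apply: projection_corner_norm_le1; last exact: qP.
apply: (@corner_eq0 e b t) => //.
- by rewrite /b !cmulA ee.
- by rewrite /b -!cmulA ee.
- by rewrite /b !cstarM qgsa esa cmulA.
- by rewrite ltr_wpDr.
- rewrite /t scalerDl scale1r addrAC (le_trans (ler_normD _ _)) //.
  rewrite lerD // ?corner // normrZ ger0_norm // ler_piMr //.
  exact: projection_norm_le1.
- have -> : t *: e + b =
      e ** p ** e + \sum_(i | rest i) (e - e ** q i ** e).
    rewrite /t bE scalerDl scale1r scaler_suml sumrB -!addrA; congr (_ + _).
    under eq_bigr do rewrite scale1r.
    by rewrite addrC; congr (_ + _); rewrite addrCA subrr addr0.
  apply: (le_trans (ler_normD _ _)); apply: lerD.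
    have e1 := projection_norm_le1 eP; have p1 := projection_norm_le1 pP.
    apply: (le_trans (cnormM _ _)).
    rewrite -[leRHS]mulr1 ler_pM // (le_trans (cnormM _ _)) //.
    by rewrite -[leRHS]mulr1 ler_pM.
  apply: (le_trans (ler_norm_sum _ _ _)).
  apply: ler_sum => i /andP[/andP[Qi _] _].
  exact: corner.
Qed.

(** The range of each summand lies in the range of the sum. *)
Lemma projection_sum_mull (I : finType) (Q : pred I) (q : I -> U) :
    (forall i, Q i -> projection (q i)) -> projection (\sum_(i | Q i) q i) ->
  forall j, Q j -> (\sum_(i | Q i) q i) ** q j = q j.
Proof.
move=> qP pP j Qj; rewrite cmul_suml (bigD1 j) //= (qP j Qj).1.
rewrite big1 ?addr0 // => i /andP[Qi ij].
exact: (projection_sum_orthogonal qP pP).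
Qed.

End Corner.

(** * Graph algebras and Cuntz-Krieger algebras *)

Section GraphCuntzKrieger.
Variable R : realType.
Local Notation K := R[i].

Section GraphFamily.
Variables (E : digraph) (U : cstarAlgType K).
Variables (p : vertex E -> U) (t : edge E -> U).
Hypothesis pt : graph_family p t.

Lemma graph_family_source e : p (source e) ** t e = t e.
Proof.
case: pt => pP _ tP _ pE; rewrite -{1}(tP e) cmulA pE.
rewrite (@projection_sum_mull R U _ _ (fun e => t e ** (t e)^#)) ?tP //.
- by move=> f _; exact: projection_mul_star.
- by rewrite -pE.
Qed.

Lemma graph_family_target e : t e ** p (target e) = t e.
Proof. by case: pt => _ _ tP <- _; rewrite cmulA tP. Qed.

Lemma graph_family_source_star e : (t e)^# ** p (source e) = (t e)^#.
Proof.
case: pt => pP _ _ _ _.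
by rewrite -(pP (source e)).2 -cstarM graph_family_source.
Qed.

Lemma graph_family_target_star e : p (target e) ** (t e)^# = (t e)^#.
Proof.
case: pt => pP _ _ _ _.
by rewrite -(pP (target e)).2 -cstarM graph_family_target.
Qed.

(** Orthogonality of the ranges: for different sources because the vertex
    projections are orthogonal, for a common source v because the ranges add up
    to the projection p v. *)
Lemma graph_family_orthogonal e f : e != f -> (t e)^# ** t f = 0.
Proof.
case: pt => pP pO tP tt pE ef.
have [sef|sef] := eqVneq (source e) (source f); last first.
  rewrite -graph_family_source_star -(graph_family_source f).
  by rewrite -cmulA (cmulA (p _)) pO // cmul0l cmul0r.
rewrite -(partial_isometry_star (tP e)) -{1}(tP f) -!cmulA (cmulA (t e)).
rewrite (cmulA (t f)) (cmulA (_ ** _)).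
rewrite (@projection_sum_orthogonal _ _ _ (fun g => source g == source f)
  (fun g => t g ** (t g)^#)) ?cmul0l ?cmul0r ?sef //.
- by move=> g _; exact: projection_mul_star.
- by rewrite -pE.
Qed.

End GraphFamily.

Variables (E : digraph) (M : vertex E -> vertex E -> nat).
Hypothesis ME :
  forall v w, M v w = #|[pred e : edge E | (source e == v) && (target e == w)]|.
Hypothesis M1 : forall v w, (M v w <= 1)%N.

(** As M counts edges, this turns the sums over edges of the graph relations
    into the sums over symbols of the Cuntz-Krieger relations. *)
Lemma sum_edges_target (U : cstarAlgType K) (F : vertex E -> U) v :
  \sum_(e | source e == v) F (target e) = \sum_w F w *+ M v w.
Proof.
rewrite (partition_big (@target E) predT) //=; apply: eq_bigr => w _.
rewrite ME -sumr_const; apply: eq_bigr => e.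
by move=> /andP[_ /eqP ->].
Qed.

Lemma edge_eq_endpoints (e f : edge E) :
  source e = source f -> target e = target f -> e = f.
Proof.
move=> sef tef; have := M1 (source f) (target f); rewrite ME.
by move/card_le1_eqP; apply; rewrite inE /= ?sef ?tef !eqxx.
Qed.

Section GraphToCK.
Variables (U : cstarAlgType K) (p : vertex E -> U) (t : edge E -> U).
Hypothesis pt : graph_family p t.

Definition vertex_isometry v : U := \sum_(e | source e == v) t e.

(** The cross terms t_e t_f^* vanish: two distinct edges with the same source
    have distinct targets, as there are no multiple edges, and the projections
    of these targets are orthogonal. *)
Lemma vertex_isometry_mul_star v :
  vertex_isometry v ** (vertex_isometry v)^# = p v.
Proof.
case: (pt) => pP pO tP tt pE.
rewrite pE cmul_suml; apply: eq_bigr => e se.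
rewrite cstar_sum cmul_sumr (bigD1 e) //= big1 ?addr0 // => f /andP[sf fe].
have [tef|tef] := eqVneq (target e) (target f).
  by case/eqP: fe; apply: edge_eq_endpoints; rewrite ?(eqP se) ?(eqP sf).
rewrite -(graph_family_target pt e) -(graph_family_target_star pt f).
by rewrite -cmulA (cmulA (p _)) pO // cmul0l cmul0r.
Qed.

Lemma vertex_isometry_star_mul v :
  (vertex_isometry v)^# ** vertex_isometry v = \sum_w p w *+ M v w.
Proof.
case: (pt) => pP pO tP tt pE.
rewrite -sum_edges_target cstar_sum cmul_suml; apply: eq_bigr => e se.
rewrite cmul_sumr (bigD1 e) //= tt big1 ?addr0 // => f /andP[sf fe].
by rewrite (graph_family_orthogonal pt) // eq_sym.
Qed.

Lemma vertex_isometry_edge e : vertex_isometry (source e) ** p (target e) = t e.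
Proof.
case: (pt) => pP pO tP tt pE.
rewrite cmul_suml (bigD1 e) //= graph_family_target // big1 ?addr0 //.
move=> f /andP[/eqP sf fe].
rewrite -(graph_family_target pt f) -cmulA pO ?cmul0r //.
by apply: contraNneq fe => tfe; apply/eqP/edge_eq_endpoints.
Qed.

(** The algebra of a graph family is not assumed to be unital.  A unit arises
    because the elements on which the sum P of the vertex projections acts as a
    unit form a closed star-subalgebra containing the generators. *)
Lemma graph_unit : generates (range p `|` range t) -> is_unit (\sum_v p v).
Proof.
case: (pt) => pP pO tP tt pE gen; set P := \sum_v p v.
have Psa : P^# = P.
  by rewrite cstar_sum; apply: eq_bigr => v _; rewrite (pP v).2.
have Pp v : P ** p v = p v.
  rewrite cmul_suml (bigD1 v) //= (pP v).1 big1 ?addr0 // => w wv.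
  exact: pO.
have pPr v : p v ** P = p v.
  by have := congr1 (@cstar K U) (Pp v); rewrite cstarM Psa (pP v).2.
suff S : [set x | P ** x = x] `&` [set x | x ** P = x] = setT.
  by move=> x; case/seteqP: S => _ /(_ x I)[].
apply: gen.
- split=> [|a x y [/= Px xP] [/= Py yP]|x y [/= Px xP] [/= Py yP]|x [/= Px xP]].
  + by rewrite /= cmul0l cmul0r.
  + by split=> /=; rewrite ?cmulDr ?cmulDl ?cmulZl ?cmulZr ?Px ?xP ?Py ?yP.
  + by split=> /=; rewrite ?cmulA ?Px // -cmulA yP.
  + by split=> /=; rewrite -{1}Psa -cstarM ?Px ?xP.
- by apply: closedI; [exact: closed_left_unit|exact: closed_right_unit].
- move=> x [] [v _ <-]; split=> //=.
  + by rewrite -(graph_family_source pt) cmulA Pp.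
  + by rewrite -{1}(graph_family_target pt) -cmulA pPr graph_family_target.
Qed.

Lemma vertex_isometry_CK_family :
  generates (range p `|` range t) -> CK_family M vertex_isometry.
Proof.
move=> gen; split=> [v||v].
- rewrite /partial_isometry vertex_isometry_mul_star cmul_sumr.
  by apply: eq_bigr => e /eqP <-; rewrite graph_family_source.
- under eq_bigr do rewrite vertex_isometry_mul_star.
  exact: graph_unit.
- rewrite vertex_isometry_star_mul.
  by apply: eq_bigr => w _; rewrite vertex_isometry_mul_star.
Qed.

End GraphToCK.

Section CKToGraph.
Variables (V : cstarAlgType K) (s : vertex E -> V).
Hypothesis sP : CK_family M s.

Definition vertex_projection v : V := s v ** (s v)^#.

Definition edge_isometry e : V := s (source e) ** vertex_projection (target e).

Lemma vertex_projectionP v : projection (vertex_projection v).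
Proof. by case: sP => pi _ _; exact: projection_mul_star. Qed.

(** The sum of these projections is the unit, which is a projection. *)
Lemma vertex_projection_orthogonal v w :
  v != w -> vertex_projection v ** vertex_projection w = 0.
Proof.
case: sP => pi unit _.
apply: (@projection_sum_orthogonal _ _ _ predT) => // [u _|].
  exact: vertex_projectionP.
split; first exact: (unit _).1.
by rewrite cstar_sum; apply: eq_bigr => u _; rewrite (vertex_projectionP u).2.
Qed.

Lemma sum_edge_isometry v : \sum_(e | source e == v) edge_isometry e = s v.
Proof.
case: sP => pi _ ss.
rewrite -[RHS]pi -cmulA ss -(sum_edges_target vertex_projection) cmul_sumr.
by apply: eq_bigr => e /eqP <-.
Qed.

Lemma CK_graph_family : graph_family vertex_projection edge_isometry.
Proof.
have tt e :
    (edge_isometry e)^# ** edge_isometry e = vertex_projection (target e).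
  case: sP => pi _ ss; have [pp psa] := vertex_projectionP (target e).
  rewrite cstarM psa cmulA -(cmulA _ _ (s _)) ss.
  rewrite -(sum_edges_target vertex_projection) cmul_sumr (bigD1 e) //= pp big1 ?addr0 // => f /andP[/eqP sf fe].
  rewrite vertex_projection_orthogonal //.
  by apply: contraNneq fe => tef; apply/eqP/edge_eq_endpoints.
split=> //.
- exact: vertex_projectionP.
- exact: vertex_projection_orthogonal.
- move=> e; rewrite /partial_isometry -cmulA tt -cmulA.
  by rewrite (vertex_projectionP _).1.
- move=> v; transitivity (s v ** ((s v)^# ** s v) ** (s v)^#).
    by case: sP => pi _ _; rewrite cmulA pi.
  case: sP => _ _ ->; rewrite -(sum_edges_target vertex_projection).
  rewrite cmul_sumr cmul_suml; apply: eq_bigr => e /eqP <-.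
  rewrite /edge_isometry cstarM (vertex_projectionP _).2 cmulA.
  rewrite -(cmulA (s _) (vertex_projection _) (vertex_projection _)).
  by rewrite (vertex_projectionP _).1.
Qed.

End CKToGraph.

(** The composites fix the generators: s_v is the sum of the s_v p_w over the w
    with M(v,w) = 1, since s_v = s_v (s_v^* s_v), and t_e = s_v p_w for an edge e
    from v to w. *)
Lemma graph_algebra_iso_CK (U V : cstarAlgType K) :
  is_graph_algebra E U -> is_CK_algebra M V -> star_isomorphic U V.
Proof.
move=> [p [t [pt ptgen ptuniv]]] [s [sP sgen suniv]].
have [f [fP fp ft]] := ptuniv _ _ _ (CK_graph_family sP).
have [g gP gs] := suniv _ _ (vertex_isometry_CK_family pt ptgen).
have gfp v : g (f (p v)) = p v.
  rewrite fp (star_homM gP) (star_hom_star gP) gs.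
  exact: vertex_isometry_mul_star.
exists f => //; exists g => x.
- apply: (star_hom_fixes (star_hom_comp fP gP) ptgen) => {x} _ [] [e _ <-] //=.
  rewrite ft (star_homM gP) gs -fp gfp.
  exact: vertex_isometry_edge.
- apply: (star_hom_fixes (star_hom_comp gP fP) sgen) => {x} _ [v _ <-] /=.
  rewrite gs (star_hom_sum fP) -[RHS](sum_edge_isometry sP).
  by apply: eq_bigr => e _; rewrite ft.
Qed.

End GraphCuntzKrieger.

(** * Extension of strips to points of the shift *)

Section Extension.
Variable k : nat.
Implicit Types A B : 'M[nat]_k.

Lemma mulmx_nat_gt0P A B i j :
  reflect (exists l, A i l <> 0%N /\ B l j <> 0%N) (0 < (A *m B) i j)%N.
Proof.
rewrite mxE lt0n; apply: (iffP idP) => [|[l [Al Bl]]].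
  apply: contra_neqP => /forallNP H; apply: big1 => l _.
  have [Al|Al] := eqVneq (A i l) 0%N; first by rewrite Al mul0r.
  have [->|Bl] := eqVneq (B l j) 0%N; first by rewrite mulr0.
  by case: (H l); split; apply/eqP.
rewrite (bigD1 l) //= addn_eq0 muln_eq0.
by move/eqP/negPf: Al => ->; move/eqP/negPf: Bl => ->.
Qed.

Lemma coherent_sym A B : coherent A B -> coherent B A.
Proof.
have tr (C D : 'M[nat]_k) i j : (C *m D) i j = (D^T *m C^T) j i.
  by rewrite -trmx_mul [RHS]mxE.
case=> AB ABt; split=> i j; first by split=> /AB.
by rewrite tr trmxK (tr A^T) trmxK; split=> /ABt.
Qed.

Lemma matrix_shift_transpose A B x :
  matrix_shift A B x <-> matrix_shift B A (fun i j => x j i).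
Proof. by split=> xX i j; have [] := xX j i. Qed.

Lemma transition_eq1 A i j : transition_matrix A -> A i j <> 0%N -> A i j = 1%N.
Proof. by case=> A01 _ _; case: (A01 i j). Qed.

Section Fill.
Variables A B : 'M[nat]_k.
Hypotheses (trA : transition_matrix A) (trB : transition_matrix B).
Hypothesis cohAB : coherent A B.

(** The symbols a, b, c are the lower left, lower right and upper left corners
    of a unit square.  The path from c to b through a is counted by B^t A, the one
    through the upper right corner by A B^t. *)
Lemma fill_upper_right a b c : A a b = 1%N -> B a c = 1%N ->
  exists d, A c d = 1%N /\ B b d = 1%N.
Proof.
move=> ab ac; case: cohAB => _ ABt.
have /ABt/mulmx_nat_gt0P[d [cd]] : (0 < (B^T *m A)%R c b)%N.
  by apply/mulmx_nat_gt0P; exists a; rewrite mxE ab ac.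
by rewrite mxE => bd; exists d; split; apply: transition_eq1.
Qed.

(** The new row is built from left to right: its first symbol is any symbol that
    may follow above the first symbol of r, and each further symbol is the upper
    right corner of a unit square whose other corners are known. *)
Lemma extend_row_up (r : nat -> 'I_k) : (forall i, A (r i) (r i.+1) = 1%N) ->
  exists r' : nat -> 'I_k,
    forall i, A (r' i) (r' i.+1) = 1%N /\ B (r i) (r' i) = 1%N.
Proof.
move=> rA.
have [c0 c0B] : exists c, B (r 0%N) c = 1%N.
  case: (trB) => _ row _; have [c /(transition_eq1 trB) ?] := row (r 0%N).
  by exists c.
have fill (i : nat) c : exists d,
    B (r i) c = 1%N -> A c d = 1%N /\ B (r i.+1) d = 1%N.
  have [rc|nrc] := pselect (B (r i) c = 1%N); last by exists c.
  by have [d] := fill_upper_right (rA i) rc; exists d.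
have {fill}[F FP] := choice (fun ic : nat * 'I_k => fill ic.1 ic.2).
pose r' := fix r' i := if i is i'.+1 then F (i', r' i') else c0.
have rB i : B (r i) (r' i) = 1%N.
  by elim: i => //= i IH; have [] := FP (i, r' i) IH.
by exists r' => i; split=> //; have [] := FP (i, r' i) (rB i).
Qed.

(** The top row of the strip is continued upwards, one row at a time. *)
Lemma extend_strip_up n (z : nat -> nat -> 'I_k) : (0 < n)%N ->
    (forall i j, (j < n)%N -> A (z i j) (z i.+1 j) = 1%N) ->
    (forall i j, (j.+1 < n)%N -> B (z i j) (z i j.+1) = 1%N) ->
  exists2 x, matrix_shift A B x & forall i j, (j < n)%N -> x i j = z i j.
Proof.
case: n => // n _ zA zB.
have up (r : nat -> 'I_k) : exists r' : nat -> 'I_k,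
    (forall i, A (r i) (r i.+1) = 1%N) ->
    forall i, A (r' i) (r' i.+1) = 1%N /\ B (r i) (r' i) = 1%N.
  have [rA|nrA] := pselect (forall i, A (r i) (r i.+1) = 1%N); last by exists r.
  by have [r'] := extend_row_up rA; exists r'.
have {up}[F FP] := choice up.
pose top d := iter d F (z^~ n).
have topA d i : A (top d i) (top d i.+1) = 1%N.
  elim: d i => [|d IH] i /=; first exact: zA.
  exact: (FP _ IH i).1.
pose x i j := if (j < n)%N then z i j else top (j - n)%N i.
exists x => [i j|i j jn]; rewrite /x; last first.
  case: ltnP => // nj; suff -> : j = n by rewrite subnn.
  by apply/eqP; rewrite eqn_leq nj -ltnS jn.
split; first by case: ltnP => // jn; apply: zA; apply: ltnW.
have [jn|jn] := ltnP j.+1 n; first by rewrite (ltnW jn); apply: zB; apply: ltnW.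
case: ltnP => [jn'|nj].
  have nE : n = j.+1 by apply/eqP; rewrite eqn_leq jn jn'.
  by rewrite nE subnn /top /= nE; apply: zB; rewrite nE.
by rewrite subSn //=; exact: (FP _ (topA _) i).2.
Qed.

End Fill.

(** Transposition exchanges A with B, and coherence is symmetric in them. *)
Lemma extend_strip_right A B n (z : nat -> nat -> 'I_k) :
    transition_matrix A -> transition_matrix B -> coherent A B -> (0 < n)%N ->
    (forall i j, (i < n)%N -> B (z i j) (z i j.+1) = 1%N) ->
    (forall i j, (i.+1 < n)%N -> A (z i j) (z i.+1 j) = 1%N) ->
  exists2 x, matrix_shift A B x & forall i j, (i < n)%N -> x i j = z i j.
Proof.
move=> trA trB /coherent_sym cohBA n0 zB zA.
have [||x xX xz] := extend_strip_up trB trA cohBA (z := fun i j => z j i) n0.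
- by move=> i j; apply: zB.
- by move=> i j; apply: zA.
exists (fun i j => x j i); last by move=> i j; apply: xz.
exact/matrix_shift_transpose.
Qed.

End Extension.

(** * The transition matrices of the strips *)

Section Strips.
Variables (k : nat) (A B : 'M[nat]_k).
Hypotheses (trA : transition_matrix A) (trB : transition_matrix B).
Hypothesis cohAB : coherent A B.

(** A block may be assumed to occur at the origin, the shift being invariant
    under translations. *)
Lemma block_point m n (u : block A B m n) :
  exists2 x, matrix_shift A B x & val u = window x 0 0 m n.
Proof.
have /asboolP[x [a [b [xX ->]]]] := valP u.
exists (fun i j => x (a + i)%N (b + j)%N).
  by move=> i j; rewrite !addnS; exact: xX.
by apply/ffunP => ij; rewrite !ffunE.
Qed.

Lemma matA_le1 n (u u' : block A B 1 n) : (matA A B n u u' <= 1)%N.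
Proof.
case: n u u' => [|[|n]] u u' //=; last by rewrite /matA_step; case: ifP.
case: trA => A01 _ _.
by case: (A01 (val u (ord0, ord0)) (val u' (ord0, ord0))) => ->.
Qed.

Lemma matB_le1 n (u u' : block A B n 1) : (matB A B n u u' <= 1)%N.
Proof.
case: n u u' => [|[|n]] u u' //=; last by rewrite /matB_step; case: ifP.
case: trB => B01 _ _.
by case: (B01 (val u (ord0, ord0)) (val u' (ord0, ord0))) => ->.
Qed.

(** The quantifier is split in the way in which A_n and B_n are defined: the
    last symbol against the block of the others. *)
Lemma forall_ord_max n (P : 'I_n.+1 -> Prop) :
  (forall i, P i) <-> P ord_max /\ forall i, P (widen_ord (leq_pred n.+1) i).
Proof.
split=> [H|[Pm Pw] i]; first by split.
have [im|im] := eqVneq i ord_max; first by rewrite im.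
have lt : (i < n)%N by rewrite ltn_neqAle im -ltnS ltn_ord.
by have := Pw (Ordinal lt); congr P; apply: val_inj.
Qed.

Lemma matA_eq1 n (u u' : block A B 1 n) : (0 < n)%N ->
  matA A B n u u' = 1%N <->
  forall j, A (val u (ord0, j)) (val u' (ord0, j)) = 1%N.
Proof.
case: n u u' => // n u u' _; elim: n u u' => [|n IH] u u' /=.
  by split=> [H j|H]; [rewrite (ord1 j)|exact: H].
rewrite forall_ord_max /matA_step; case: ifP => H.
  split=> // _; move: H; rewrite muln_eq1 => /andP[/eqP-> /eqP/IH H].
  split=> // j.
  by have := H j; rewrite !ffunE.
split=> // -[Am H']; move: H; rewrite Am mul1n => /eqP[].
by apply/IH => j; rewrite !ffunE; exact: H'.
Qed.

Lemma matB_eq1 n (u u' : block A B n 1) : (0 < n)%N ->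
  matB A B n u u' = 1%N <->
  forall i, B (val u (i, ord0)) (val u' (i, ord0)) = 1%N.
Proof.
case: n u u' => // n u u' _; elim: n u u' => [|n IH] u u' /=.
  by split=> [H j|H]; [rewrite (ord1 j)|exact: H].
rewrite forall_ord_max /matB_step; case: ifP => H.
  split=> // _; move: H; rewrite muln_eq1 => /andP[/eqP-> /eqP/IH H].
  split=> // j.
  by have := H j; rewrite !ffunE.
split=> // -[Am H']; move: H; rewrite Am mul1n => /eqP[].
by apply/IH => j; rewrite !ffunE; exact: H'.
Qed.

Lemma matA_window n x x' (u u' : block A B 1 n) : (0 < n)%N ->
    val u = window x 0 0 1 n -> val u' = window x' 0 0 1 n ->
  matA A B n u u' = 1%N <->
  forall j, (j < n)%N -> A (x 0%N j) (x' 0%N j) = 1%N.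
Proof.
move=> n0 uE uE'; rewrite matA_eq1 // uE uE'; split=> H j.
  by move=> jn; have := H (Ordinal jn); rewrite !ffunE /=.
by rewrite !ffunE; apply: H; exact: ltn_ord.
Qed.

Lemma matB_window n x x' (u u' : block A B n 1) : (0 < n)%N ->
    val u = window x 0 0 n 1 -> val u' = window x' 0 0 n 1 ->
  matB A B n u u' = 1%N <->
  forall i, (i < n)%N -> B (x i 0%N) (x' i 0%N) = 1%N.
Proof.
move=> n0 uE uE'; rewrite matB_eq1 // uE uE'; split=> H j.
  by move=> jn; have := H (Ordinal jn); rewrite !ffunE /=.
by rewrite !ffunE; apply: H; exact: ltn_ord.
Qed.

Lemma block_left_right n (e f : block A B 2 n) :
  left_block e = left_block f -> right_block e = right_block f -> e = f.
Proof.
move=> /(congr1 val)/ffunP L /(congr1 val)/ffunP Rt.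
apply/val_inj/ffunP => -[[[|[|//]] i2] j].
  have := L (ord0, j); rewrite !ffunE /=.
  by rewrite (_ : widen_ord _ _ = Ordinal i2) //; apply: val_inj.
have := Rt (ord0, j); rewrite !ffunE /=.
by rewrite (_ : succ_ord _ = Ordinal i2) //; apply: val_inj.
Qed.

Lemma block_lower_upper n (e f : block A B n 2) :
  lower_block e = lower_block f -> upper_block e = upper_block f -> e = f.
Proof.
move=> /(congr1 val)/ffunP L /(congr1 val)/ffunP Rt.
apply/val_inj/ffunP => -[i [[|[|//]] j2]].
  have := L (i, ord0); rewrite !ffunE /=.
  by rewrite (_ : widen_ord _ _ = Ordinal j2) //; apply: val_inj.
have := Rt (i, ord0); rewrite !ffunE /=.
by rewrite (_ : succ_ord _ = Ordinal j2) //; apply: val_inj.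
Qed.

(** Let v and w be the initial columns of the points x and y of the shift.  If
    A_n(v,w) = 1, then v followed by the strip of y is an admissible strip, and
    its extension to a point of the shift has the wanted block at the origin. *)
Lemma matA_edge n (v w : block A B 1 n) : (0 < n)%N ->
  matA A B n v w = 1%N <->
  exists e : block A B 2 n, left_block e = v /\ right_block e = w.
Proof.
move=> n0; have [x xX vE] := block_point v; have [y yX wE] := block_point w.
rewrite (matA_window n0 vE wE); split=> [xy|[e [ev ew]] j jn].
  pose z i := if i is i'.+1 then y i' else x 0%N.
  have [||t tX tz] := extend_strip_up trA trB cohAB (z := z) n0.
  - by case=> [|i] j jn /=; [exact: xy|exact: (yX i j).1].
  - by case=> [|i] j _ /=; [exact: (xX 0%N j).2|exact: (yX i j).2].
  have eP : `[< occurs A B (window t 0 0 2 n) >].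
    by apply/asboolP; exists t, 0%N, 0%N.
  exists (Sub (window t 0 0 2 n) eP).
  split; apply: val_inj; apply/ffunP => -[i j]; rewrite ?vE ?wE !ffunE /=;
    by rewrite tz ?ltn_ord // (ord1 i).
have [t tX eE] := block_point e.
have -> : x 0%N j = t 0%N j.
  have := congr1 (fun u : block A B 1 n => val u (ord0, Ordinal jn)) ev.
  by rewrite /= vE ffunE eE !ffunE.
have -> : y 0%N j = t 1%N j.
  have := congr1 (fun u : block A B 1 n => val u (ord0, Ordinal jn)) ew.
  by rewrite /= wE ffunE eE !ffunE.
exact: (tX 0%N j).1.
Qed.

Lemma matB_edge n (v w : block A B n 1) : (0 < n)%N ->
  matB A B n v w = 1%N <->
  exists e : block A B n 2, lower_block e = v /\ upper_block e = w.
Proof.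
move=> n0; have [x xX vE] := block_point v; have [y yX wE] := block_point w.
rewrite (matB_window n0 vE wE); split=> [xy|[e [ev ew]] i lt_in].
  pose z i j := if j is j'.+1 then y i j' else x i 0%N.
  have [||t tX tz] := extend_strip_right (z := z) trA trB cohAB n0.
  - by move=> i [|j] lt_in /=; [exact: xy|exact: (yX i j).2].
  - by move=> i [|j] _ /=; [exact: (xX i 0%N).1|exact: (yX i j).1].
  have eP : `[< occurs A B (window t 0 0 n 2) >].
    by apply/asboolP; exists t, 0%N, 0%N.
  exists (Sub (window t 0 0 n 2) eP).
  split; apply: val_inj; apply/ffunP => -[i j]; rewrite ?vE ?wE !ffunE /=;
    by rewrite tz ?ltn_ord // (ord1 j).
have [t tX eE] := block_point e.
have -> : x i 0%N = t i 0%N.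
  have := congr1 (fun u : block A B n 1 => val u (Ordinal lt_in, ord0)) ev.
  by rewrite /= vE ffunE eE !ffunE.
have -> : y i 0%N = t i 1%N.
  have := congr1 (fun u : block A B n 1 => val u (Ordinal lt_in, ord0)) ew.
  by rewrite /= wE ffunE eE !ffunE.
exact: (tX i 0%N).2.
Qed.

Lemma card_pred_le1 (T : finType) (P : pred T) (m : nat) :
    (m <= 1)%N -> (m = 1%N <-> exists e, P e) ->
    (forall e f, P e -> P f -> e = f) ->
  m = #|P|.
Proof.
move=> m1 mP Puniq.
have P1 : (#|P| <= 1)%N by apply/card_le1_eqP => e f Pe Pf; exact: Puniq.
have [/existsP/mP mE|nP] := boolP [exists e, P e].
  apply/eqP; rewrite mE eqn_leq P1 andbT.
  by apply/card_gt0P; case: mP => /(_ mE)[e Pe] _; exists e.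
have -> : #|P| = 0%N.
  apply: eq_card0 => e; apply/negbTE; apply: contra nP => Pe.
  by apply/existsP; exists e.
case: m m1 mP => [|[|//]] // _ [/(_ erefl) [e Pe] _].
by case/negP: nP; apply/existsP; exists e.
Qed.

Lemma shiftY_A_markov n : (0 < n)%N ->
  shiftY_A A B n = markov_shift (matA A B n).
Proof.
move=> n0; apply/seteqP; split=> [y [x xX yx] i|y yM].
  apply/matA_eq1 => // j; rewrite !yx !ffunE /= !addn0.
  exact: (xX _ _).1.
have /choice[p pP] i : exists x,
    matrix_shift A B x /\ val (y i) = window x 0 0 1 n.
  by have [x xX yE] := block_point (y i); exists x.
have [||x xX xp] := extend_strip_up trA trB cohAB (z := fun i => p i 0%N) n0.
- move=> i j; have := yM i; rewrite (matA_window n0 (pP i).2 (pP i.+1).2).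
  exact.
- by move=> i j _; exact: ((pP i).1 _ _).2.
exists x => // i; rewrite (pP i).2; apply/ffunP => -[a j].
by rewrite !ffunE /= (ord1 a) !addn0 xp ?ltn_ord.
Qed.

Lemma shiftY_B_markov n : (0 < n)%N ->
  shiftY_B A B n = markov_shift (matB A B n).
Proof.
move=> n0; apply/seteqP; split=> [y [x xX yx] j|y yM].
  apply/matB_eq1 => // i; rewrite !yx !ffunE /= !addn0.
  exact: (xX _ _).2.
have /choice[p pP] j : exists x,
    matrix_shift A B x /\ val (y j) = window x 0 0 n 1.
  by have [x xX yE] := block_point (y j); exists x.
have [||x xX xp] :=
  extend_strip_right (z := fun i j => p j i 0%N) trA trB cohAB n0.
- move=> i j; have := yM j; rewrite (matB_window n0 (pP j).2 (pP j.+1).2).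
  exact.
- by move=> i j _; exact: ((pP j).1 _ _).1.
exists x => // j; rewrite (pP j).2; apply/ffunP => -[i a].
by rewrite !ffunE /= (ord1 a) !addn0 xp ?ltn_ord.
Qed.

End Strips.

Theorem theorem4p2 (R : realType) (k : nat) (A B : 'M[nat]_k)
    (trA : transition_matrix A) (trB : transition_matrix B)
    (cohAB : coherent A B) :
  (forall n : nat, (2 <= n)%N ->
     (forall U V : cstarAlgType R[i],
        is_graph_algebra (graphGbar A B 2 n) U ->
        is_CK_algebra (matA A B n) V ->
        star_isomorphic U V) /\
     (forall U V : cstarAlgType R[i],
        is_graph_algebra (graphG A B n 2) U ->
        is_CK_algebra (matB A B n) V ->
        star_isomorphic U V)) /\
  (forall n : nat, (1 <= n)%N ->
     shiftY_A A B n = markov_shift (matA A B n) /\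
     shiftY_B A B n = markov_shift (matB A B n)).
Proof.
split=> [n /ltnW n0|n n0]; last first.
  by split; [exact: shiftY_A_markov|exact: shiftY_B_markov].
split=> U V; apply: graph_algebra_iso_CK => v w.
- apply: card_pred_le1 => [||e f /andP[/eqP ev /eqP ew] /andP[/eqP fv /eqP fw]].
  + exact: matA_le1.
  + rewrite matA_edge //; split=> -[e].
      by move=> [<- <-]; exists e; rewrite /= !eqxx.
    by move=> /andP[/eqP ? /eqP ?]; exists e.
  + exact: (block_left_right (etrans ev (esym fv)) (etrans ew (esym fw))).
- exact: matA_le1.
- apply: card_pred_le1 => [||e f /andP[/eqP ev /eqP ew] /andP[/eqP fv /eqP fw]].
  + exact: matB_le1.
  + rewrite matB_edge //; split=> -[e].
      by move=> [<- <-]; exists e; rewrite /= !eqxx.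
    by move=> /andP[/eqP ? /eqP ?]; exists e.
  + exact: (block_lower_upper (etrans ev (esym fv)) (etrans ew (esym fw))).
- exact: matB_le1.
Qed.
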